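(* Let $n,d\in\mathbb{N}$. The polynomial $h_{2d}(x_1,\dots,x_n)$ is a sum of $\binom{n-1+d}{d}$ squares in $\mathbb{R}[x_1,\dots,x_n]$. Furthermore, for all $\mathbf{x}=(x_1,\dots,x_n)\in\mathbb{R}^n$, $$h_{2d}(x_1,\dots,x_n)\ge\frac{\mu_{n,d}}{n^{d-1}}\,\|\mathbf{x}\|_2^{2d}.$$
   Context: $\mathbb{N}$ denotes the positive integers. The complete homogeneous symmetric polynomial of degree $d$ is $h_d(x_1,\dots,x_n)=\sum_{1\le i_1\le\cdots\le i_d\le n}x_{i_1}\cdots x_{i_d}$, the sum of all monomials of degree $d$ in $n$ commuting variables. $\|\mathbf{x}\|_2$ is the Euclidean norm. The constant $\mu_{n,d}$ is $$\mu_{n,d}=\begin{cases}1 & \text{if } n=1,\\[4pt] \dfrac{\binom{n-1+2d}{2d}}{\binom{n-1+d}{d}\left(\binom{n-1+d}{d}+1\right)} & \text{if } n\ge 2 \text{ and } d \text{ is odd},\\[10pt] \dfrac{\binom{n-1+2d}{2d}}{\binom{n-1+d}{d}\left(\binom{n-1+d}{d}+n-1\right)} & \text{if } n\ge 2\text{ and } d\text{ is even}.\end{cases}$$ *)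

(* Defs.v *)
From HB Require Import structures.
From mathcomp Require Export all_boot all_order all_algebra.
From mathcomp Require Export reals.
From mathcomp Require Export mpoly.

Set Implicit Arguments.
Unset Strict Implicit.
Unset Printing Implicit Defensive.

Import GRing.Theory Num.Theory.
Local Open Scope ring_scope.

(* A tuple [i_1 <= ... <= i_d] of indices stands for one monomial of degree d. *)
Definition complete_hsym (R : comNzRingType) (n d : nat) : {mpoly R[n]} :=
  \sum_(t : d.-tuple 'I_n | sorted leq [seq nat_of_ord i | i <- t])
    \prod_(i <- t) 'X_i.

Definition is_sum_of_squares (A : pzRingType) (k : nat) (a : A) : Prop :=
  exists q : 'I_k -> A, a = \sum_(j < k) q j ^+ 2.

(* The library norm on row vectors is the sup norm, hence this definition. *)
Definition norm2 (R : realType) (n : nat) (x : 'I_n -> R) : R :=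
  Num.sqrt (\sum_(i < n) x i ^+ 2).

(* Only meaningful for n >= 1: the subtractions [n - 1] are truncated. *)
Definition mu (R : realType) (n d : nat) : R :=
  let N := 'C(n - 1 + d, d) in
  if n == 1%N then 1
  else if odd d then
    'C(n - 1 + 2 * d, 2 * d)%:R / (N%:R * (N%:R + 1))
  else
    'C(n - 1 + 2 * d, 2 * d)%:R / (N%:R * (N%:R + n%:R - 1)).

(* Main.v *)
Require Import Defs.
From mathcomp Require Import ring lra zify.

Set Implicit Arguments.
Unset Strict Implicit.
Unset Printing Implicit Defensive.

Import Order.TTheory GRing.Theory Num.Theory.

Local Open Scope ring_scope.

(** Write [h k] for the complete homogeneous polynomial of degree [k] in [n]
    variables, and put [N = 'C(n-1+d, d)], [M = 'C(n-1+2d, 2d)], so that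
    [mu = M / (N * K)] for [n >= 2], with [K = N + 1] or [K = N + n - 1] according
    to the parity of [d].

    Sum of squares.  Vandermonde's identity in every variable gives
      ['C(a+b, a) h (a+b) = \sum_(al, be) \prod_i 'C(al_i + be_i, al_i) x^(al + be)],
    the sum being over exponents of degrees [a] and [b]; and the kernel
    factors as ['C(i+j, i) = \sum_k 'C(i, k) 'C(j, k)].  Hence
    ['C(2d, d) h (2d)] is the sum over [c] of the squares of
    [\sum_al \prod_i 'C(al_i, c_i) x^al] ([sum_whsym_mul]).  These are too many
    squares, but they all live in the span of the [N] monomials of degree [d], and
    completing squares one generator at a time leaves only [N] of them
    ([sum_squares_reduce]).

    Lower bound.  It follows from two estimates, one good for many variables
    and one for high degree.
    - When [n >= d] and [n > 2], keep only the squares with [|c| = d]: they are the squared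
      monomials, so ['C(2d, d) h (2d) (x) >= h d (x^2)].  On nonnegative
      arguments Chebyshev's sum inequality gives
      [h d (y) >= N (y_1 + ... + y_n)^d / n^d] ([hsym_ge_mean]).
    - When [n < d] or [n <= 2], use [2^(n-1) h (2d) (x) >= \sum_i x_i^(2d)]
      ([even_hsym_ge_psum]).  If all [x_i] have the same sign, this is clear.
      Otherwise take [x > 0 > y] among them: the divided difference identity
      [(x - y) h k (x, y, s) = x h k (x, s) - y h k (y, s)]
      writes [h (2d)] as a convex combination of its values with one of the two
      variables deleted, and each such deletion costs a factor of at most [2].
      The power mean inequality then compares the power sum with the Euclidean
      norm.

    It remains to compare constants ([regimes]).  All products of binomial
    coefficients involved satisfy first order recurrences in [n] and [d], so the
    two comparisons propagate by induction from the diagonal and from finitely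
    many small cases.  Only [n = d = 3] escapes both, where [mu = 14/55] slightly
    exceeds [1/4]; there one uses the divided difference identity once, with two
    variables of equal sign kept together ([hsym6_size3_ge]). *)

(** * Complete homogeneous polynomials of a list *)

Fixpoint exps (n k : nat) : seq (seq nat) :=
  if n is n'.+1 then [seq i :: e | i <- iota 0 k.+1, e <- exps n' (k - i)]
  else if k == 0%N then [:: [::]] else [::].

Fixpoint monom (A : comNzRingType) (s : seq A) (e : seq nat) : A :=
  match s, e with
  | y :: s', i :: e' => y ^+ i * monom s' e'
  | _, _ => 1
  end.

(** Lists of ring elements, rather than families indexed by ['I_n], allow
    variables to be deleted, repeated and permuted, as the proofs by induction
    on the variables require. *)
Definition hsym (A : comNzRingType) (s : seq A) (k : nat) : A :=
  \sum_(e <- exps (size s) k) monom s e.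

Lemma big_exps (A : nmodType) (n k : nat) (F : seq nat -> A) :
  \sum_(e <- exps n.+1 k) F e =
  \sum_(i < k.+1) \sum_(e <- exps n (k - i)) F (nat_of_ord i :: e).
Proof.
rewrite -(big_mkord xpredT (fun i => \sum_(e <- exps n (k - i)) F (i :: e))).
by rewrite /index_iota subn0 -big_allpairs_dep.
Qed.

Lemma size_exps n k : size (exps n.+1 k) = 'C(n + k, k).
Proof.
rewrite -sum1_size; elim: n k => [|n IHn] k.
  rewrite big_exps add0n binn big_ord_recr subnn big1 => [|i _]; last 1 first.
    by rewrite /exps /= subn_eq0 leqNgt ltn_ord big_nil.
  by rewrite /= big_seq1.
have hk m : (\sum_(e <- exps n.+2 m) 1 = \sum_(i < m.+1) 'C(n + i, i))%N.
  rewrite (reindex_inj rev_ord_inj) big_exps; apply: eq_bigr => i _ /=.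
  by rewrite subSS IHn.
rewrite hk; elim: k => [|k IHk]; first by rewrite big_ord1 !bin0.
by rewrite big_ord_recr IHk /= addSn [in RHS]addSn binS addnC addnS.
Qed.

Section HSym.
Variable A : comNzRingType.
Implicit Types (s : seq A) (x y : A).

Lemma hsym_nil k : hsym [::] k = (k == 0%N)%:R :> A.
Proof. by rewrite /hsym /=; case: eqP => _; rewrite ?big_seq1 ?big_nil. Qed.

Lemma hsym_cons y s k : hsym (y :: s) k = \sum_(i < k.+1) y ^+ i * hsym s (k - i).
Proof.
by rewrite /hsym big_exps; apply: eq_bigr => i _; rewrite mulr_sumr.
Qed.

Lemma hsym0 s : hsym s 0 = 1.
Proof.
by elim: s => [|y s IH]; rewrite ?hsym_nil ?hsym_cons // big_ord1 IH mulr1.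
Qed.

Lemma hsym_consS y s k : hsym (y :: s) k.+1 = hsym s k.+1 + y * hsym (y :: s) k.
Proof.
rewrite !hsym_cons big_ord_recl mul1r subn0 mulr_sumr; congr (_ + _).
by apply: eq_bigr => i _; rewrite exprS mulrA.
Qed.

(** [h k] is the divided difference of [t |-> t * h k (t, s)] at [x] and [y]. This
    trades two variables for one and drives both the symmetry of [hsym] and
    the lower bounds. *)
Lemma hsym_divdiff x y s k :
  (x - y) * hsym (x :: y :: s) k = x * hsym (x :: s) k - y * hsym (y :: s) k.
Proof.
elim: k => [|k IHk]; first by rewrite !hsym0 !mulr1.
rewrite (hsym_consS x (y :: s)) mulrDr mulrCA IHk (hsym_consS x s).
rewrite (hsym_consS y s); ring.
Qed.

(** The divided difference is symmetric in [x] and [y], but [x - y] cannot be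
    cancelled in a general ring; hence the induction on the degree. *)
Lemma hsym_swap x y s k : hsym (x :: y :: s) k = hsym (y :: x :: s) k.
Proof.
elim: k => [|k IHk]; first by rewrite !hsym0.
have := hsym_divdiff x y s k.
rewrite (hsym_consS x (y :: s)) (hsym_consS y (x :: s)) -IHk.
rewrite (hsym_consS x s) (hsym_consS y s) => h.
have -> : x * hsym (x :: s) k = (x - y) * hsym (x :: y :: s) k + y * hsym (y :: s) k.
  by rewrite h; ring.
ring.
Qed.

Lemma hsym_cat_cons x s1 s2 k : hsym (s1 ++ x :: s2) k = hsym (x :: s1 ++ s2) k.
Proof.
elim: s1 k => [//|y s1 IH] k.
rewrite hsym_swap /= !(hsym_cons y); by apply: eq_bigr => i _; rewrite IH.
Qed.

Lemma hsym_perm s1 s2 k : perm_eq s1 s2 -> hsym s1 k = hsym s2 k.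
Proof.
elim: s1 s2 k => [|x s1 IH] s2 k; first by rewrite perm_sym => /perm_nilP->.
move=> h; have xs2 : x \in s2 by rewrite -(perm_mem h) mem_head.
case/splitPr: xs2 h => p q; rewrite perm_sym perm_catC /= perm_cons perm_sym => h.
rewrite hsym_cat_cons !hsym_cons; apply: eq_bigr => i _.
by rewrite (IH (p ++ q)) // perm_sym perm_catC perm_sym.
Qed.

Lemma hsymZ c s k : hsym [seq c * y | y <- s] k = c ^+ k * hsym s k.
Proof.
elim: s k => [|y s IH] k /=; first by case: k => [|k]; rewrite !hsym_nil ?mulr1 ?mulr0.
rewrite !hsym_cons mulr_sumr; apply: eq_bigr => i _.
rewrite IH exprMn mulrACA -exprD subnKC // -ltnS; exact: ltn_ord.
Qed.

End HSym.

(** * Sorted tuples of indices *)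

Section Words.
Variables (A : comNzRingType) (n : nat) (f : 'I_n -> A).

(** The weakly increasing words over [l], built by the same recursion on
    the leading letter as [hsym_consS]. *)
Fixpoint words (l : seq 'I_n) : nat -> seq (seq 'I_n) :=
  if l is y :: l' then
    fix wk k :=
      if k is k'.+1 then [seq y :: w | w <- wk k'] ++ words l' k else [:: [::]]
  else fun k => if k == 0%N then [:: [::]] else [::].

Let ordle (i j : 'I_n) := (i <= j)%N.
Let ordlt (i j : 'I_n) := (i < j)%N.

Lemma hsym_words l k : hsym (map f l) k = \sum_(w <- words l k) \prod_(i <- w) f i.
Proof.
elim: l k => [|y l IHl] k.
  by rewrite hsym_nil /=; case: eqP; rewrite ?big_seq1 ?big_nil.
elim: k => [|k IHk]; first by rewrite hsym0 /= big_seq1 big_nil.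
rewrite [map _ _]/= hsym_consS IHl IHk [words _ k.+1]/= big_cat /= addrC; congr (_ + _).
by rewrite big_map mulr_sumr; apply: eq_bigr => w _; rewrite big_cons.
Qed.

Lemma mem_words l k w : sorted ordlt l ->
  (w \in words l k) = [&& size w == k, sorted ordle w & all (mem l) w].
Proof.
elim: l k w => [|y l IHl] k w hl.
  by case: w k => [|i w] [|k] //=; rewrite ?inE ?andbF.
have tr : transitive ordlt by move=> a b c; exact: ltn_trans.
have trle : transitive ordle by move=> a b c; exact: leq_trans.
have hl' : sorted ordlt l by case: (l) hl => //= z l1 /andP[].
have yl : all (ordlt y) l by exact: order_path_min hl.
elim: k w => [|k IHk] w; first by case: w => [|i w]; rewrite inE.
rewrite [words _ _]/= mem_cat IHl //; case: w => [|i w].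
  by apply/orP => -[/mapP[]//|//].
rewrite /= eqSS inE (path_sortedE trle).
have [->|niy] /= := eqVneq i y.
  rewrite mem_map ?IHk; last by move=> ? ? [].
  have -> : (y \in l) = false.
    by apply/negP => /(allP yl); rewrite /ordlt ltnn.
  rewrite /= !andbF orbF; case: eqP => //= _.
  case hw: (all _ w); rewrite ?andbF //.
  suff -> : all (ordle y) w by rewrite andbT.
  apply/allP => z /(allP hw); rewrite inE => /orP[/eqP->|].
    exact: leqnn.
  by move/(allP yl)/ltnW.
have -> : (i :: w \in [seq y :: w0 | w0 <- words (y :: l) k]) = false.
  by apply/negP => /mapP[w' _ [/eqP]]; rewrite (negbTE niy).
rewrite orFb; case: eqP => //= _.
have [il|] /= := boolP (i \in l); last by rewrite !andbF.
have [hi|] /= := boolP (all (ordle i) w) => //; congr (_ && _).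
apply: eq_in_all => z zw /=; rewrite inE.
suff -> : (z == y) = false by [].
apply/negP => /eqP zy; move: (allP hi _ zw) (allP yl _ il).
by rewrite zy /ordle /ordlt leqNgt => /negP.
Qed.

Lemma uniq_words l k : sorted ordlt l -> uniq (words l k).
Proof.
elim: l k => [|y l IHl] k hl; first by rewrite /=; case: eqP.
have hl' : sorted ordlt l by case: (l) hl => //= z l1 /andP[].
have tr : transitive ordlt by move=> a b c; exact: ltn_trans.
have yl : all (ordlt y) l by exact: order_path_min hl.
elim: k => [//|k IHk].
rewrite [words _ _]/= cat_uniq IHl // map_inj_uniq ?IHk ?andbT //=.
  apply/hasPn => w; rewrite mem_words // => /and3P[_ _ /allP hw].
  apply/negP => /mapP[w' _ hww']; have /hw : y \in w by rewrite hww' mem_head.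
  by move=> /(allP yl); rewrite /ordlt ltnn.
by move=> ? ? [].
Qed.

Lemma sum_sorted_tuples k :
  \sum_(t : k.-tuple 'I_n | sorted leq [seq nat_of_ord i | i <- t]) \prod_(i <- t) f i
  = hsym [seq f i | i <- enum 'I_n] k.
Proof.
have se : sorted ordlt (enum 'I_n).
  have := iota_ltn_sorted 0 n; rewrite -val_enum_ord sorted_map.
  by congr sorted.
rewrite hsym_words -big_filter.
rewrite -(big_map (@tval k 'I_n) xpredT (fun w => \prod_(i <- w) f i)).
apply: perm_big; apply: uniq_perm.
  by rewrite map_inj_uniq ?filter_uniq ?index_enum_uniq //; exact: val_inj.
  exact: uniq_words.
move=> w; rewrite mem_words //.
have -> : all (mem (enum 'I_n)) w by apply/allP => i _; rewrite /= mem_enum.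
rewrite andbT; apply/mapP/andP => [[t]|[/eqP hs hw]].
  rewrite mem_filter => /andP[ht _] ->; rewrite size_tuple; split=> //.
  by move: ht; rewrite sorted_map.
have hs' : size w == k by apply/eqP.
exists (Tuple hs') => //; rewrite mem_filter mem_index_enum andbT.
by rewrite sorted_map.
Qed.
End Words.

Lemma complete_hsymE (R : comNzRingType) n k :
  complete_hsym R n k = hsym [seq 'X_i | i <- enum 'I_n] k.
Proof. exact: sum_sorted_tuples. Qed.

Lemma complete_hsym_eval (R : comNzRingType) n k (x : 'I_n -> R) :
  (complete_hsym R n k).@[x] = hsym [seq x i | i <- enum 'I_n] k.
Proof.
rewrite -sum_sorted_tuples /complete_hsym rmorph_sum; apply: eq_bigr => t _ /=.
by rewrite rmorph_prod; apply: eq_bigr => i _; rewrite /= mevalXU.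
Qed.

(** * Euler's identity *)

Section Euler.
Variable A : comNzRingType.
Implicit Types (s : seq A).

(** Since [h k] with [y] repeated is the partial derivative of [h (k+1)] in [y],
    this is Euler's identity for a homogeneous polynomial of degree [k+1]. *)
Lemma sum_mul_hsym_cons s k :
  \sum_(y <- s) y * hsym (y :: s) k = k.+1%:R * hsym s k.+1.
Proof.
elim: s k => [|x s IHs] k; first by rewrite big_nil hsym_nil mulr0.
elim: k => [|k IHk].
  rewrite big_cons hsym0 mulr1 mul1r hsym_consS hsym0 mulr1 addrC; congr (_ + _).
  rewrite -[RHS]mul1r -(IHs 0%N).
  by apply: eq_bigr => y _; rewrite !hsym0.
have h y : y * hsym (y :: x :: s) k.+1 =
           y * hsym (y :: s) k.+1 + x * (y * hsym (y :: x :: s) k).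
  by rewrite hsym_swap hsym_consS hsym_swap; ring.
rewrite big_cons (hsym_consS x (x :: s)) (eq_bigr _ (fun y _ => h y)).
rewrite big_split /= -mulr_sumr IHs.
have -> : \sum_(y <- s) y * hsym (y :: x :: s) k =
    k.+1%:R * hsym (x :: s) k.+1 - x * hsym (x :: x :: s) k.
  by rewrite -IHk big_cons; ring.
rewrite (hsym_consS x s k.+1) -[k.+2%:R]natr1; ring.
Qed.

(** The sum of all partial derivatives of [h (k+1)], read off from
    Euler's identity in degree [k]. *)
Lemma sum_hsym_cons s k :
  \sum_(y <- s) hsym (y :: s) k = (size s + k)%:R * hsym s k.
Proof.
case: k => [|k].
  rewrite (eq_bigr (fun=> 1)) => [|y _]; last by rewrite hsym0.
  by rewrite big_const_seq count_predT hsym0 mulr1 addn0 iter_addr_0.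
rewrite (eq_bigr _ (fun y _ => hsym_consS y s k)) big_split /= sum_mul_hsym_cons.
by rewrite big_const_seq count_predT iter_addr_0 -[_ *+ size s]mulr_natl -mulrDl natrD.
Qed.
End Euler.

Lemma hsym_seq1 (A : comNzRingType) (y : A) k : hsym [:: y] k = y ^+ k.
Proof.
elim: k => [|k IHk]; first by rewrite hsym0.
by rewrite hsym_consS hsym_nil add0r IHk exprS.
Qed.

(** * Lower bounds over an ordered field *)

Section Positive.
Variable R : realFieldType.
Implicit Types (s : seq R) (x y : R).

Lemma hsym_ge0 s k : (forall y, y \in s -> 0 <= y) -> 0 <= hsym s k.
Proof.
elim: s k => [|y s IH] k hs; first by rewrite hsym_nil ler0n.
rewrite hsym_cons; apply: sumr_ge0 => i _; apply: mulr_ge0.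
  by apply: exprn_ge0; apply: hs; rewrite mem_head.
by apply: IH => z zs; apply: hs; rewrite inE zs orbT.
Qed.

Lemma hsym_ge_pow y s k : 0 <= y -> (forall z, z \in s -> 0 <= z) ->
  y ^+ k <= hsym (y :: s) k.
Proof.
move=> y0 hs; rewrite hsym_cons big_ord_recr /= subnn hsym0 mulr1 lerDr.
apply: sumr_ge0 => i _; apply: mulr_ge0; first exact: exprn_ge0.
exact: hsym_ge0.
Qed.

Lemma hsym_ge_psum s k : (forall y, y \in s -> 0 <= y) ->
  \sum_(y <- s) y ^+ k.+1 <= hsym s k.+1.
Proof.
elim: s => [|y s IH] hs; first by rewrite big_nil hsym_nil.
have y0 : 0 <= y by apply: hs; rewrite mem_head.
have hs' z : z \in s -> 0 <= z by move=> zs; apply: hs; rewrite inE zs orbT.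
rewrite big_cons hsym_consS addrC lerD ?IH // exprS ler_wpM2l //.
exact: hsym_ge_pow.
Qed.

Lemma subrX_mul_ge0 k x y : 0 <= x -> 0 <= y -> 0 <= (x - y) * (x ^+ k - y ^+ k).
Proof.
move=> x0 y0; rewrite subrXX mulrA -expr2; apply: mulr_ge0; first exact: sqr_ge0.
by apply: sumr_ge0 => i _; apply: mulr_ge0; apply: exprn_ge0.
Qed.

(** Deleting one of two variables of opposite signs, as [hsym_divdiff] permits,
    costs a factor [2], and at most [n] deletions reach a list of constant sign,
    where the power sum is part of [h (2d)]. The estimate is sharp for [n = 1] at
    [y = - x]. *)
Lemma even_hsym_ge_psum n s d : size s = n.+1 ->
  \sum_(y <- s) y ^+ (2 * d.+1) <= 2 ^+ n * hsym s (2 * d.+1).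
Proof.
elim: n s => [|n IHn] s sn.
  case: s sn => [//|y [|//]] _; rewrite mul1r big_seq1.
  by rewrite hsym_seq1.
have e2 (z : R) : z ^+ (2 * d.+1) = (z ^+ d.+1) ^+ 2 by rewrite mulnC exprM.
have ge2 (t : R) : 0 <= t -> t <= 2 ^+ n.+1 * t.
  by move=> t0; rewrite ler_peMl // exprn_ege1 // ler1n.
have [/allP pos|/allPn [y ys]] := boolP (all (fun y => 0 <= y) s).
  apply: le_trans (ge2 _ (hsym_ge0 _ pos)); rewrite (mulnS 2).
  exact: hsym_ge_psum.
(* An even degree does not see a global change of sign. *)
have [/allP neg _|/allPn [x xs]] := boolP (all (fun y => y <= 0) s).
  have nn z : z \in [seq -1 * y | y <- s] -> 0 <= z.
    by case/mapP => t /neg t0 ->; rewrite mulN1r oppr_ge0.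
  have eqs : hsym s (2 * d.+1) = hsym [seq -1 * y | y <- s] (2 * d.+1).
    by rewrite hsymZ exprM sqrrN !expr1n mul1r.
  rewrite eqs; apply: le_trans (ge2 _ (hsym_ge0 _ nn)).
  have -> : \sum_(y <- s) y ^+ (2 * d.+1) =
            \sum_(y <- [seq -1 * y | y <- s]) y ^+ (2 * d.+1).
    rewrite big_map; apply: eq_bigr => z _.
    by rewrite exprMn (exprM (-1)) sqrrN !expr1n mul1r.
  by rewrite (mulnS 2); exact: hsym_ge_psum.
rewrite -!ltNge => x0 y0.
have xy : x != y by apply/eqP => xy; move: x0; rewrite xy ltNge (ltW y0).
have [s' hs'] : exists s', perm_eq s [:: x, y & s'].
  have ys' : y \in rem x s.
    by move: ys; rewrite (perm_mem (perm_to_rem xs)) inE eq_sym (negbTE xy).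
  exists (rem y (rem x s)); apply: (perm_trans (perm_to_rem xs)).
  by rewrite perm_cons perm_to_rem.
rewrite (hsym_perm _ hs') (perm_big _ hs') /= !big_cons.
have sz : size s' = n by have := perm_size hs'; rewrite sn /= => -[].
have hx := IHn (x :: s') (congr1 S sz); have hy := IHn (y :: s') (congr1 S sz).
have hd := hsym_divdiff x y s' (2 * d.+1).
move: hx hy; rewrite !big_cons.
set S := \sum_(_ <- _) _; set hx := hsym (x :: s') _; set hy := hsym (y :: s') _.
rewrite -/hx -/hy in hd; set h := hsym _ _ in hd *.
move=> ix iy.
have dxy : 0 < x - y by rewrite subr_gt0; apply: lt_trans x0.
rewrite -(ler_pM2l dxy) mulrCA exprS hd.
have jx := ler_wpM2l (ltW x0) ix.
have ny0 : 0 <= - y by rewrite oppr_ge0 ltW.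
have jy := ler_wpM2l ny0 iy.
(* With [X] and [Y] the powers of [x] and [y], this is twice the excess of
   [x X - y Y] over [(x - y) (X + Y) / 2]. *)
have key : 0 <= (x + y) * (x ^+ (2 * d.+1) - y ^+ (2 * d.+1)).
  have -> : y ^+ (2 * d.+1) = (- y) ^+ (2 * d.+1) by rewrite !exprM sqrrN.
  by have := subrX_mul_ge0 (2 * d.+1) (ltW x0) ny0; rewrite opprK.
have S0 : 0 <= S by apply: sumr_ge0 => z _; rewrite e2 sqr_ge0.
have := mulr_ge0 (ltW dxy) S0.
move: jx jy key; set P := 2 ^+ n; set X := x ^+ _; set Y := y ^+ _.
move=> jx jy key S1; rewrite -subr_ge0.
have -> : 2 * P * (x * hx - y * hy) - (x - y) * (X + (Y + S)) =
  2 * (x * (P * hx) - x * (X + S)) + 2 * (- y * (P * hy) - - y * (Y + S))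
  + (x + y) * (X - Y) + (x - y) * S by ring.
by rewrite !addr_ge0 // mulr_ge0 ?subr_ge0.
Qed.

Lemma chebyshev_sum (T : eqType) (s : seq T) (f g : T -> R) :
  (forall x y : T, x \in s -> y \in s -> 0 <= (f x - f y) * (g x - g y)) ->
  (\sum_(x <- s) f x) * (\sum_(x <- s) g x) <= (size s)%:R * \sum_(x <- s) f x * g x.
Proof.
move=> hfg.
have : 0 <= \sum_(x <- s) \sum_(y <- s) (f x - f y) * (g x - g y).
  rewrite big_seq; apply: sumr_ge0 => x xs; rewrite big_seq.
  by apply: sumr_ge0 => y ys; exact: hfg.
have -> : \sum_(x <- s) \sum_(y <- s) (f x - f y) * (g x - g y) =
  2 * ((size s)%:R * (\sum_(x <- s) f x * g x) -
       (\sum_(x <- s) f x) * (\sum_(x <- s) g x)).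
  transitivity (\sum_(x <- s) ((size s)%:R * (f x * g x) + \sum_(y <- s) f y * g y
      - (f x * \sum_(y <- s) g y + g x * \sum_(y <- s) f y))).
    apply: eq_bigr => x _.
    rewrite !mulr_sumr -big_split /= mulr_natl -iter_addr_0 -count_predT -big_const_seq.
    by rewrite -big_split -sumrB; apply: eq_bigr => y _ /=; ring.
  rewrite sumrB !big_split /= -!mulr_suml -mulr_sumr.
  rewrite big_const_seq count_predT iter_addr_0 -mulr_natl; ring.
by rewrite pmulr_rge0 ?ltr0n // subr_ge0.
Qed.

(** By Euler's identity this is Chebyshev's sum inequality for the variables and
    the partial derivatives of [h (k+1)]: these are ordered alike, because their
    differences are [x - y] times a polynomial with nonnegative coefficients. *)
Lemma hsym_chebyshev s k : (forall y, y \in s -> 0 <= y) ->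
  (size s + k)%:R * ((\sum_(y <- s) y) * hsym s k) <= (size s * k.+1)%:R * hsym s k.+1.
Proof.
move=> hs; rewrite mulrCA -sum_hsym_cons natrM -mulrA -sum_mul_hsym_cons.
apply: chebyshev_sum => x y xs ys.
have -> : hsym (x :: s) k - hsym (y :: s) k =
          (x - y) * if k is k'.+1 then hsym [:: x, y & s] k' else 0.
  case: k => [|k]; first by rewrite !hsym0; ring.
  by rewrite hsym_divdiff !hsym_consS; ring.
rewrite mulrA; apply: mulr_ge0; first by rewrite -expr2 sqr_ge0.
case: k => [//|k]; apply: hsym_ge0 => z.
by rewrite !inE => /or3P[/eqP->|/eqP->|]; apply: hs.
Qed.

(** The normalised polynomial [h k / 'C(m + k, k)] dominates the [k]-th power of
    the mean, by iterating the Chebyshev step. *)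
Lemma hsym_ge_mean s m k : size s = m.+1 -> (forall y, y \in s -> 0 <= y) ->
  'C(m + k, k)%:R * (\sum_(y <- s) y) ^+ k <= m.+1%:R ^+ k * hsym s k.
Proof.
move=> sm hs; have S0 : 0 <= \sum_(y <- s) y by rewrite big_seq; apply: sumr_ge0.
elim: k => [|k IHk]; first by rewrite bin0 hsym0.
have := hsym_chebyshev k hs; rewrite sm => hc.
have k0 : (0 : R) < k.+1%:R by rewrite ltr0n.
rewrite -(ler_pM2l k0).
have -> : k.+1%:R * ('C(m + k.+1, k.+1)%:R * (\sum_(y <- s) y) ^+ k.+1) =
  ((m.+1 + k)%:R * (\sum_(y <- s) y)) * ('C(m + k, k)%:R * (\sum_(y <- s) y) ^+ k) :> R.
  rewrite mulrA -natrM addnS -mul_bin_diag /= natrM exprS addSn; ring.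
apply: (@le_trans _ _ (((m.+1 + k)%:R * (\sum_(y <- s) y)) * (m.+1%:R ^+ k * hsym s k))).
  by apply: ler_wpM2l => //; apply: mulr_ge0.
have -> : k.+1%:R * (m.+1%:R ^+ k.+1 * hsym s k.+1) =
   m.+1%:R ^+ k * ((m.+1 * k.+1)%:R * hsym s k.+1) :> R by rewrite exprS natrM; ring.
have -> : ((m.+1 + k)%:R * (\sum_(y <- s) y)) * (m.+1%:R ^+ k * hsym s k) =
  m.+1%:R ^+ k * ((m.+1 + k)%:R * ((\sum_(y <- s) y) * hsym s k)) :> R by ring.
by apply: ler_wpM2l => //; exact: exprn_ge0.
Qed.

Lemma power_mean s k : (forall y, y \in s -> 0 <= y) ->
  (\sum_(y <- s) y) ^+ k.+1 <= (size s)%:R ^+ k * \sum_(y <- s) y ^+ k.+1.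
Proof.
move=> hs; have S0 : 0 <= \sum_(y <- s) y by rewrite big_seq; apply: sumr_ge0.
elim: k => [|k IHk]; first by rewrite mul1r.
rewrite exprS; apply: le_trans (ler_wpM2l S0 IHk) _.
rewrite mulrCA exprSr -mulrA; apply: ler_wpM2l; first exact: exprn_ge0.
rewrite (eq_bigr _ (fun y _ => exprS y k.+1)).
apply: chebyshev_sum => x y xs ys.
by apply: subrX_mul_ge0; apply: hs.
Qed.
End Positive.

(** * Decomposition into squares *)

Fixpoint mbin (c e : seq nat) : nat :=
  match c, e with
  | k :: c', i :: e' => ('C(i, k) * mbin c' e')%N
  | _, _ => 1%N
  end.

(** Up to the monomial [x^c] this is the Hasse derivative of order [c] of [h a]. *)
Definition whsym (A : comNzRingType) (s : seq A) (c : seq nat) (a : nat) : A :=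
  \sum_(e <- exps (size s) a) (mbin c e)%:R * monom s e.

(** All exponents with entries at most [D]. Any [D] at least the degrees in play
    gives the same sums, which is what lets the induction on the variables
    keep [D] fixed while the degrees drop. *)
Fixpoint box (n D : nat) : seq (seq nat) :=
  if n is n'.+1 then [seq k :: c | k <- iota 0 D.+1, c <- box n' D] else [:: [::]].

Lemma big_box (A : nmodType) n D (P : pred (seq nat)) (F : seq nat -> A) :
  \sum_(c <- box n.+1 D | P c) F c =
  \sum_(k < D.+1) \sum_(c <- box n D | P (nat_of_ord k :: c)) F (nat_of_ord k :: c).
Proof.
rewrite big_mkcond -(big_mkord xpredT (fun k => \sum_(c <- box n D | P (k :: c)) F (k :: c))).
rewrite /index_iota subn0 big_allpairs_dep; apply: eq_bigr => k _.
by rewrite [RHS]big_mkcond.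
Qed.

Lemma size_box n D c : c \in box n D -> size c = n.
Proof.
elim: n c => [|n IH] c; first by rewrite inE => /eqP->.
by case/allpairsP => -[k c'] [_ /IH sc' ->] /=; rewrite sc'.
Qed.

Section Gram.
Variable A : comNzRingType.
Implicit Types (s : seq A) (c : seq nat).

Lemma whsym_nil c a : whsym [::] c a = (a == 0%N)%:R :> A.
Proof.
rewrite /whsym /=; case: eqP => _; rewrite ?big_nil ?big_seq1 //=.
by case: c => [|k c]; rewrite mulr1.
Qed.

Lemma whsym_cons y s k c a :
  whsym (y :: s) (k :: c) a =
  \sum_(i < a.+1) 'C(i, k)%:R * y ^+ i * whsym s c (a - i).
Proof.
rewrite /whsym big_exps; apply: eq_bigr => i _; rewrite mulr_sumr.
by apply: eq_bigr => e _ /=; rewrite natrM; ring.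
Qed.

Lemma sum_bin_mul i j D : (j <= D)%N ->
  (\sum_(k < D.+1) 'C(i, k) * 'C(j, k) = 'C(i + j, i))%N.
Proof.
move=> jD; rewrite -[RHS]bin_sub ?leq_addr // addKn -binomial.Vandermonde.
rewrite (big_ord_widen D.+1 (fun k => 'C(i, k) * 'C(j, j - k))%N) // [RHS]big_mkcond /=.
apply: eq_bigr => k _; case: ltnP => kj; first by rewrite bin_sub.
by rewrite (bin_small kj) muln0.
Qed.

(** Vandermonde's identity splits the binomial coefficient of the total degree
    between the first variable and the others. *)
Lemma binom_hsym_cons y s a b :
  'C(a + b, a)%:R * hsym (y :: s) (a + b) =
  \sum_(i < a.+1) \sum_(j < b.+1) 'C(i + j, i)%:R * y ^+ (i + j)
     * ('C(a - i + (b - j), a - i)%:R * hsym s (a - i + (b - j))).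
Proof.
rewrite hsym_cons mulr_sumr.
pose F i m : A := ('C(m, i) * 'C(a + b - m, a - i))%:R * (y ^+ m * hsym s (a + b - m)).
transitivity (\sum_(m < (a + b).+1) \sum_(i < a.+1) F i m).
  apply: eq_bigr => m _; rewrite -mulr_suml -natr_sum binomial.Vandermonde subnKC //.
  by rewrite -ltnS.
(* For fixed [i], only [i <= m <= i + b] contributes; then [j] is [m - i]. *)
rewrite exchange_big /=; apply: eq_bigr => i _.
have ia : (i <= a)%N by rewrite -ltnS.
rewrite -(big_mkord xpredT (F i)) (big_cat_nat _ (n := i)) //=; last by lia.
rewrite big_nat big1 ?add0r => [|m /andP[_ mi]]; last first.
  by rewrite /F bin_small // mul0n mul0r.
rewrite (big_cat_nat _ (n := (b.+1 + i)%N)) //=; [|by lia|by lia].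
rewrite [X in _ + X]big_nat [X in _ + X]big1 ?addr0 => [|m /andP[mi mab]]; last first.
  by rewrite /F [X in (_ * X)%N]bin_small ?muln0 ?mul0r //; lia.
rewrite -{1}[nat_of_ord i]add0n big_addn addnK big_mkord; apply: eq_bigr => j _.
have jb : (j <= b)%N by rewrite -ltnS.
have -> : F i (j + i)%N = F i (i + j)%N by rewrite addnC.
rewrite /F natrM (_ : a + b - (i + j) = a - i + (b - j))%N; last by lia.
by ring.
Qed.

(** The Gram matrix of ['C(a + b, a) h (a + b)] is a tensor product, over the
    variables, of Pascal matrices ['C(i + j, i)], each of which factors through
    [sum_bin_mul]. *)
Lemma sum_whsym_mul s D a b : (a <= D)%N -> (b <= D)%N ->
  \sum_(c <- box (size s) D) whsym s c a * whsym s c b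
  = 'C(a + b, a)%:R * hsym s (a + b).
Proof.
elim: s a b => [|y s IH] a b aD bD.
  rewrite /= big_seq1 !whsym_nil hsym_nil.
  by case: a b {aD bD} => [|a] [|b]; rewrite ?mulr0 ?mul0r ?bin0 // addn0 mulr0.
rewrite binom_hsym_cons /= big_box.
pose G (k : nat) c a i := 'C(i, k)%:R * y ^+ i * whsym s c (a - i).
transitivity (\sum_(k < D.+1) \sum_(c <- box (size s) D)
   \sum_(i < a.+1) \sum_(j < b.+1) G k c a i * G k c b j).
  apply: eq_bigr => k _; apply: eq_bigr => c _; rewrite !whsym_cons mulr_suml.
  by apply: eq_bigr => i _; rewrite mulr_sumr.
rewrite (eq_bigr _ (fun k _ => exchange_big _ _ _ _ _ _)) /= exchange_big /=.
apply: eq_bigr => i _.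
rewrite (eq_bigr _ (fun k _ => exchange_big _ _ _ _ _ _)) /= exchange_big /=.
apply: eq_bigr => j _.
have jb : (j <= b)%N by rewrite -ltnS.
rewrite -IH ?(leq_trans (leq_subr _ _)) // -(@sum_bin_mul i j D) ?(leq_trans jb) //.
rewrite natr_sum !mulr_suml; apply: eq_bigr => k _.
rewrite mulr_sumr; apply: eq_bigr => c _; rewrite /G natrM exprD; ring.
Qed.

Lemma whsym_eq0 s c a : size c = size s -> (a < sumn c)%N -> whsym s c a = 0.
Proof.
elim: s c a => [|y s IH] [|k c] a //= [sc] ac.
rewrite whsym_cons big1 // => i _.
case: (ltnP i k) => ik; first by rewrite bin_small // !mul0r.
by rewrite IH ?mulr0 //; have := ltn_ord i; lia.
Qed.

(** For [|c| = a] the only exponent [al] of degree [a] with [al_i >= c_i] for all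
    [i] is [c] itself, so the square is that of the monomial [x^c]. *)
Lemma sum_whsym_sqr_top s D a : (a <= D)%N ->
  \sum_(c <- box (size s) D | sumn c == a) whsym s c a ^+ 2
  = hsym [seq y ^+ 2 | y <- s] a.
Proof.
elim: s a => [|y s IH] a aD.
  rewrite /= hsym_nil big_mkcond big_seq1 eq_sym /= whsym_nil.
  by case: (a) => [|a']; rewrite ?expr1n.
rewrite /= big_box hsym_cons.
rewrite (big_ord_widen D.+1 (fun i => (y ^+ 2) ^+ i * hsym [seq y ^+ 2 | y <- s] (a - i))) //.
rewrite [RHS]big_mkcond /=; apply: eq_bigr => k _; case: ltnP => ka; last first.
  by rewrite big1 // => c /eqP/=; lia.
have ka' : (k <= a)%N by [].
rewrite -IH; last by lia.
rewrite mulr_sumr big_seq_cond [RHS]big_seq_cond.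
have e c : (k + sumn c == a)%N = (sumn c == (a - k)%N) by apply/eqP/eqP; lia.
rewrite (eq_bigl _ _ (fun c => congr1 (andb (c \in box (size s) D)) (e c))).
apply: eq_bigr => c /andP[/size_box sc /eqP sumc].
rewrite whsym_cons (bigD1 (Ordinal ka)) //= binn mul1r big1 ?addr0.
  by rewrite exprMn -!exprM mulnC.
move=> i; rewrite -val_eqE /= neq_ltn => /orP[ik|ki].
  by rewrite bin_small // !mul0r.
have := ltn_ord i => iS.
by rewrite whsym_eq0 ?mulr0 //; lia.
Qed.
End Gram.

Lemma even_hsym_ge_sqr (R : realFieldType) (s : seq R) d :
  hsym [seq y ^+ 2 | y <- s] d <= 'C(2 * d, d)%:R * hsym s (2 * d).
Proof.
rewrite mul2n -addnn -(sum_whsym_mul s (leqnn d) (leqnn d)).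
rewrite -(sum_whsym_sqr_top s (leqnn d)) [leRHS](bigID (fun c => sumn c == d)) /=.
by rewrite lerDl sumr_ge0 // => c _; rewrite -expr2 sqr_ge0.
Qed.

(** A positive semidefinite form in [N] generators is a sum of [N] squares. If the
    form is the sum of the [q j ^+ 2], project the vectors [j |-> q j] along the
    column of coefficients of the first generator: the component along it
    gives the single square [u ^+ 2], and the orthogonal part does not involve the
    first generator any more. *)
Lemma sum_squares_reduce (R : rcfType) (A : comNzRingType) (f : {rmorphism R -> A})
    (T : eqType) (J : seq T) N (v : 'I_N -> A) (c : T -> 'I_N -> R) :
  is_sum_of_squares N (\sum_(j <- J) (\sum_i f (c j i) * v i) ^+ 2).
Proof.
elim: N v c => [|N IHN] v c.
  exists (fun _ => 0); rewrite big_ord0 big1 // => j _.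
  by rewrite big_ord0 expr0n.
pose S := \sum_(j <- J) c j ord0 ^+ 2; pose r := Num.sqrt S.
have S0 : 0 <= S by apply: sumr_ge0 => j _; exact: sqr_ge0.
pose q j := \sum_i f (c j i) * v i.
pose u := f r^-1 * \sum_(j <- J) f (c j ord0) * q j.
(* [t] is the unit vector along the first column (zero if this column is), and
   [w] gives the coefficients of [u]. *)
pose t j := c j ord0 / r.
pose w (i : 'I_N.+1) := r^-1 * \sum_(j <- J) c j ord0 * c j i.
have rr : r * r = S by rewrite -expr2 sqr_sqrtr.
have uw : u = \sum_i f (w i) * v i.
  rewrite /u /w mulr_sumr.
  rewrite (eq_bigr (fun j => \sum_i f (r^-1 * (c j ord0 * c j i)) * v i)); last first.
    move=> j _; rewrite /q !mulr_sumr; apply: eq_bigr => i _.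
    by rewrite !rmorphM /=; ring.
  rewrite exchange_big /=; apply: eq_bigr => i _.
  by rewrite mulr_sumr rmorph_sum /= mulr_suml.
have ct j : j \in J -> c j ord0 = t j * w ord0.
  move=> jJ; rewrite /t /w (eq_bigr (fun j => c j ord0 ^+ 2)) // -/S.
  have [r0|r0] := eqVneq r 0; last first.
    by rewrite -rr; field.
  have : S == 0 by rewrite -rr r0 mul0r.
  rewrite psumr_eq0 => [/allP/(_ j jJ)/=|i _]; last exact: sqr_ge0.
  by rewrite sqrf_eq0 => /eqP->; rewrite !mul0r.
pose c' j i := c j (lift ord0 i) - t j * w (lift ord0 i).
have qc' j : j \in J -> q j - f (t j) * u = \sum_i f (c' j i) * v (lift ord0 i).
  move=> jJ; rewrite uw /q mulr_sumr -sumrB big_ord_recl {1}(ct j jJ).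
  rewrite (rmorphM f (t j)) mulrA subrr add0r; apply: eq_bigr => i _.
  by rewrite /c' rmorphB (rmorphM f (t j)) /=; ring.
have [p hp] := IHN (fun i => v (lift ord0 i)) c'.
exists (fun k => if unlift ord0 k is Some i then p i else u).
rewrite big_ord_recl unlift_none (eq_bigr (fun i => p i ^+ 2)); last first.
  by move=> i _; rewrite liftK.
rewrite -hp big_seq [X in _ + X]big_seq.
rewrite [X in _ + X](eq_bigr (fun j => (q j - f (t j) * u) ^+ 2)); last first.
  by move=> j /qc' ->.
rewrite -!big_seq.
change (\sum_(j <- J) q j ^+ 2 = u ^+ 2 + \sum_(j <- J) (q j - f (t j) * u) ^+ 2).
have e j : (q j - f (t j) * u) ^+ 2 =
    q j ^+ 2 - 2 * u * (f (r^-1) * (f (c j ord0) * q j)) +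
    f (r^-1 * r^-1 * c j ord0 ^+ 2) * u ^+ 2.
  by rewrite /t !rmorphM ?rmorphXn /=; ring.
rewrite (eq_bigr _ (fun j _ => e j)) big_split sumrB /= -mulr_sumr -mulr_sumr -/u.
rewrite -mulr_suml -rmorph_sum -mulr_sumr -/S.
suff -> : f (r^-1 * r^-1 * S) * u ^+ 2 = u ^+ 2 by ring.
have [r0|r0] := eqVneq r 0; last by rewrite -rr mulrACA !mulVf // mulr1 rmorph1 mul1r.
have -> : u = 0 by rewrite /u r0 invr0 rmorph0 mul0r.
by rewrite expr0n mulr0.
Qed.

Lemma even_hsym_sum_squares (R : rcfType) (A : comNzRingType) (f : {rmorphism R -> A})
    (s : seq A) d : is_sum_of_squares (size (exps (size s) d)) (hsym s (2 * d)).
Proof.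
set L := exps _ _; pose B : R := 'C(2 * d, d)%:R.
have B0 : 0 < B by rewrite ltr0n bin_gt0; lia.
pose v (i : 'I_(size L)) := monom s (nth [::] L i).
pose c e (i : 'I_(size L)) := (Num.sqrt B)^-1 * (mbin e (nth [::] L i))%:R.
have := sum_squares_reduce f (box (size s) d) v c.
suff -> : \sum_(j <- box (size s) d) (\sum_i f (c j i) * v i) ^+ 2 = hsym s (2 * d) by [].
transitivity (f B^-1 * \sum_(j <- box (size s) d) whsym s j d * whsym s j d).
  rewrite mulr_sumr; apply: eq_bigr => e _.
  have -> : \sum_i f (c e i) * v i = f (Num.sqrt B)^-1 * whsym s e d.
    rewrite /whsym -/L (big_nth [::]) big_mkord mulr_sumr; apply: eq_bigr => i _.
    by rewrite /c rmorphM rmorph_nat mulrA.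
  by rewrite exprMn -rmorphXn exprVn sqr_sqrtr ?ltW // expr2.
rewrite (sum_whsym_mul s (leqnn d) (leqnn d)) addnn -mul2n mulrA.
by rewrite -(rmorph_nat f) -rmorphM mulVf ?lt0r_neq0 // rmorph1 mul1r.
Qed.

(** * Comparison of the constants *)

Section Numeric.
Local Open Scope nat_scope.

Lemma bin_addSr a c : c.+1 * 'C(a + c.+1, c.+1) = (a + c).+1 * 'C(a + c, c).
Proof. by rewrite addnS -mul_bin_diag. Qed.

Lemma bin_addSl a c : a.+1 * 'C(a.+1 + c, c) = (a + c).+1 * 'C(a + c, c).
Proof.
have e b : 'C(b + c, c) = 'C(c + b, b) by rewrite -bin_sub ?leq_addl // addnK addnC.
by rewrite !e bin_addSr addnC.
Qed.

(** One inductive step for inequalities [c x <= y ^ 2], where [x] and [y] are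
    multiplied by the fractions [p / k] and [q / l]. *)
Lemma leq_sqr_step c x y c' x' y' k p l q :
  0 < c -> 0 < k -> 0 < l -> k * x' = p * x -> l * y' = q * y ->
  c' * p * l ^ 2 <= c * q ^ 2 * k -> c * x <= y ^ 2 -> c' * x' <= y' ^ 2.
Proof.
move=> c0 k0 l0 hx hy hpq hxy.
have pos : 0 < c * k * l ^ 2 by rewrite !muln_gt0 c0 k0 l0.
rewrite -(leq_pmul2l pos).
have -> : c * k * l ^ 2 * (c' * x') = c' * p * l ^ 2 * (c * x).
  transitivity (c * l ^ 2 * c' * (k * x')); first by lia.
  by rewrite hx; lia.
have -> : c * k * l ^ 2 * y' ^ 2 = c * q ^ 2 * k * y ^ 2.
  transitivity (c * k * (l * y') ^ 2); first by rewrite expnMn; lia.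
  by rewrite hy expnMn; lia.
exact: leq_mul.
Qed.

(** The case [d = n + 1] of the comparison for [n < d], with [n = m + 1]. The
    recurrences turn the step into the inequality of polynomials
    of leading coefficients [54] and [64]. *)
Lemma tail_diag m : 2 ^ m * 'C(m + 2 * m.+2, 2 * m.+2) <= 'C(m + m.+2, m.+2) ^ 2.
Proof.
elim: m => [//|m IHm].
apply: (leq_sqr_step (k := m.+1 * (2 * m + 5) * (2 * m + 6))
  (p := (3 * m + 5) * (3 * m + 6) * (3 * m + 7))
  (l := m.+1 * m.+3) (q := (2 * m + 3) * (2 * m + 4)) _ _ _ _ _ _ IHm).
- by rewrite expn_gt0.
- by lia.
- by lia.
- have := bin_addSl m (2 * m.+2); have := bin_addSr m.+1 (2 * m.+2).
  have := bin_addSr m.+1 (2 * m.+2).+1; rewrite (mulnS 2 m.+2).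
  rewrite -[2 + _]/((2 * m.+2).+2); set d := 2 * m.+2.
  have -> : 2 * m + 5 = d.+1 by rewrite /d; lia.
  have -> : 2 * m + 6 = d.+2 by rewrite /d; lia.
  have -> : 3 * m + 5 = (m + d).+1 by rewrite /d; lia.
  have -> : 3 * m + 6 = (m.+1 + d).+1 by rewrite /d; lia.
  have -> : 3 * m + 7 = (m.+1 + d.+1).+1 by rewrite /d; lia.
  move=> h1 h2 h3.
  rewrite -mulnA h1.
  transitivity ((m.+1 + d.+1).+1 * (m.+1 * (d.+1 * 'C(m.+1 + d.+1, d.+1)))).
    by lia.
  rewrite h2.
  transitivity ((m.+1 + d.+1).+1 * ((m.+1 + d).+1 * (m.+1 * 'C(m.+1 + d, d)))).
    by lia.
  by rewrite h3; lia.
- have := bin_addSl m m.+2; have := bin_addSr m.+1 m.+2.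
  have -> : 2 * m + 3 = (m + m.+2).+1 by lia.
  have -> : 2 * m + 4 = (m.+1 + m.+2).+1 by lia.
  move=> h1 h2; rewrite -mulnA h1 mulnCA h2; lia.
- by rewrite expnS; nia.
Qed.

(** For fixed [m], the quotient of the right-hand side by the left-hand side does
    not decrease with [d]. *)
Lemma tail_regime m d : m.+1 < d -> 2 ^ m * 'C(m + 2 * d, 2 * d) <= 'C(m + d, d) ^ 2.
Proof.
elim: d => [//|d IHd]; rewrite ltnS leq_eqVlt => /orP[/eqP<-|/IHd {}IHd].
  exact: tail_diag.
apply: (leq_sqr_step (k := (2 * d).+1 * (2 * d).+2)
  (p := (m + 2 * d).+1 * (m + (2 * d).+1).+1)
  (l := d.+1) (q := (m + d).+1) _ _ _ _ _ _ IHd) => //.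
- by rewrite expn_gt0.
- have := bin_addSr m (2 * d); have := bin_addSr m (2 * d).+1; rewrite (mulnS 2).
  rewrite -[2 + _]/((2 * d).+2) => h1 h2; rewrite -mulnA h1 mulnCA h2; lia.
- exact: bin_addSr.
- rewrite -!mulnA leq_mul2l; apply/orP; right; nia.
Qed.

(** The case [n = d = e + 1] of the comparison for [n >= d]; it fails for
    [e <= 3], so for [d = 2, 3, 4] the induction on [n] starts at [n = 4, 4, 5]. *)
Lemma square_diag e : 3 < e ->
  e.+1 * 'C(e + 2 * e.+1, e.+1) <= 'C(e + e.+1, e.+1) ^ 2.
Proof.
elim: e => [//|e IHe]; rewrite ltnS leq_eqVlt => /orP[/eqP<-|e4].
  by vm_compute.
move: (IHe e4) => {}IHe.
have e1 : e.+1 + 2 * e.+2 = (2 * e).+3 + e.+2 by lia.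
have e2 : e + 2 * e.+1 = (2 * e).+1 + e.+1 by lia.
rewrite e1; rewrite e2 in IHe.
apply: (leq_sqr_step (k := (2 * e + 2) * (2 * e + 3) * e.+2)
  (p := (3 * e + 3) * (3 * e + 4) * (3 * e + 5))
  (l := e.+1 * e.+2) (q := (2 * e + 2) * (2 * e + 3)) _ _ _ _ _ _ IHe) => //.
- by lia.
- have := bin_addSl (2 * e).+1 e.+1; have := bin_addSl (2 * e).+2 e.+1.
  have := bin_addSr (2 * e).+3 e.+1.
  have -> : 2 * e + 2 = (2 * e).+2 by lia.
  have -> : 2 * e + 3 = (2 * e).+3 by lia.
  have -> : 3 * e + 3 = ((2 * e).+1 + e.+1).+1 by lia.
  have -> : 3 * e + 4 = ((2 * e).+2 + e.+1).+1 by lia.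
  have -> : 3 * e + 5 = ((2 * e).+3 + e.+1).+1 by lia.
  move=> h1 h2 h3; rewrite -mulnA h1.
  transitivity (((2 * e).+3 + e.+1).+1 *
    ((2 * e).+2 * ((2 * e).+3 * 'C((2 * e).+3 + e.+1, e.+1)))).
    by lia.
  rewrite h2.
  transitivity (((2 * e).+3 + e.+1).+1 *
    (((2 * e).+2 + e.+1).+1 * ((2 * e).+2 * 'C((2 * e).+2 + e.+1, e.+1)))).
    by lia.
  by rewrite h3; lia.
- have := bin_addSl e e.+1; have := bin_addSr e.+1 e.+1.
  have -> : 2 * e + 2 = (e + e.+1).+1 by lia.
  have -> : 2 * e + 3 = (e.+1 + e.+1).+1 by lia.
  move=> h1 h2; rewrite -mulnA h1 mulnCA h2; lia.
(* The condition of the step, divided by its common factor [e.+1 ^ 3 * e.+2]. *)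
- have key : 3 * (3 * e + 4) * (3 * e + 5) * e.+2 ^ 2 <= 8 * e.+1 * (2 * e + 3) ^ 3.
    clear -e4; have [f ->] : exists f, e = f.+1 by exists e.-1; lia.
    by rewrite !expnS expn0; nia.
  have := leq_mul (leqnn (e.+1 ^ 3 * e.+2)) key.
  by rewrite !expnS !expn0; lia.
Qed.

(** For fixed [d], the quotient of the right-hand side by the left-hand side does
    not decrease with [m]. *)
Lemma square_step m d : 0 < d ->
  m.+1 * 'C(m + 2 * d, d) <= 'C(m + d, d) ^ 2 ->
  m.+2 * 'C(m.+1 + 2 * d, d) <= 'C(m.+1 + d, d) ^ 2.
Proof.
have e a : a + 2 * d = (a + d) + d by lia.
rewrite !e => d0 IH.
apply: (leq_sqr_step (k := (m + d).+1) (p := (m + d + d).+1)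
  (l := m.+1) (q := (m + d).+1) _ _ _ _ _ _ IH) => //.
- by rewrite addSn bin_addSl.
- exact: bin_addSl.
- nia.
Qed.

Lemma square_regime m0 m d : 0 < d -> m0 <= m ->
  m0.+1 * 'C(m0 + 2 * d, d) <= 'C(m0 + d, d) ^ 2 ->
  m.+1 * 'C(m + 2 * d, d) <= 'C(m + d, d) ^ 2.
Proof.
move=> d0 /subnK<- h; elim: (m - m0) => [//|i IH].
by rewrite addSn; exact: square_step.
Qed.

(** With [n = m + 1], the first alternative makes [mu] at most [2 ^- m] and the
    second, through [bin_exchange], makes [mu * n * 'C(2d, d)] at most [N]. *)
Lemma regimes m d (N := 'C(m + d, d)) (K := if odd d then N.+1 else N + m) :
  0 < m -> 0 < d ->
  [\/ 2 ^ m * 'C(m + 2 * d, 2 * d) <= N * K,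
      m.+1 * 'C(m + 2 * d, d) <= N * K | m = 2 /\ d = 3].
Proof.
move=> m0 d0.
have NK : N ^ 2 <= N * K.
  by rewrite expnS expn1 leq_mul2l /K; case: odd; rewrite ?leqnSn ?leq_addr orbT.
(* For [m = 1] the extra summand of [K] is needed. *)
have [m1|m1] := eqVneq m 1.
  apply: Or31; apply: (@leq_trans (N * N.+1)); last first.
    by rewrite leq_mul2l /K m1 addn1; case: (odd d); rewrite leqnn orbT.
  have bin1d k : 'C(1 + k, k) = k.+1 by rewrite -bin_sub ?leq_addl // addnK bin1.
  by rewrite /N m1 !bin1d; nia.
have [md|dm] := ltnP m.+1 d.
  by apply: Or31; apply: (leq_trans _ NK); exact: tail_regime.
have [d5|] := leqP 5 d.
  apply: Or32; apply: (leq_trans _ NK).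
  apply: (@square_regime d.-1) => //; first by lia.
  have := @square_diag d.-1; rewrite prednK //; apply; lia.
move: NK; rewrite /K /N => {N K} NK d_lt5.
(* For [d = 1] the estimate is an equality, and for [(m, d) = (2, 2)] and
   [(3, 4)] it holds only thanks to the larger [K] of the even case. *)
have [d1|[d2|[d3|d4]]] : d = 1 \/ d = 2 \/ d = 3 \/ d = 4 by lia.
- by apply: Or32; rewrite d1 !addn1 !bin1 /=; lia.
- have [m3|m3] := leqP 3 m; last first.
    have m2 : m = 2 by lia.
    by apply: Or32; rewrite d2 m2.
  by apply: Or32; apply: (leq_trans _ NK); rewrite d2; apply: (@square_regime 3).
- have [m3|m3] := leqP 3 m; last by apply: Or33; lia.
  by apply: Or32; apply: (leq_trans _ NK); rewrite d3; apply: (@square_regime 3).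
- have [m4|m4] := leqP 4 m; last first.
    have m3 : m = 3 by lia.
    by apply: Or32; rewrite d4 m3.
  by apply: Or32; apply: (leq_trans _ NK); rewrite d4; apply: (@square_regime 4).
Qed.

Lemma bin_exchange m d :
  'C(m + 2 * d, 2 * d) * 'C(2 * d, d) = 'C(m + d, d) * 'C(m + 2 * d, d).
Proof.
have f a c : 'C(a + c, c) * (c`! * a`!) = (a + c)`!.
  by rewrite -[X in _ * (_ * X`!)](addnK c) bin_fact // leq_addl.
have pos : 0 < m`! * d`! * d`! by rewrite !muln_gt0 !fact_gt0.
apply/eqP; rewrite -(eqn_pmul2r pos); apply/eqP.
have h1 := f m (2 * d); have h2 := f d d; have h3 := f m d; have h4 := f (m + d) d.
rewrite addnn -mul2n in h2; rewrite -addnA addnn -mul2n in h4.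
transitivity (m + 2 * d)`!.
  rewrite -h1 -h2; lia.
rewrite -h4 -h3; lia.
Qed.

End Numeric.

(** * Three variables, degree six *)

Section Ternary.
Variable R : realFieldType.
Implicit Types a b c x y z : R.

(** With [c = - z], what remains of the next lemma after its terms in [b]
    are discarded. *)
Lemma septic_ge0 a c : 0 <= a -> 0 <= c ->
  28 * (a ^+ 6 + c ^+ 6) * (a + c) <= 110 * a ^+ 7 + 55 * c ^+ 7.
Proof.
move=> a0 c0; rewrite -subr_ge0.
(* If [c <= 3 a / 2], the rearrangement [a^6 c + a c^6 <= a^7 + c^7] leaves
   [54 a^7 >= c^7] to be shown; otherwise [a] is small and [c^7] dominates. *)
have [ac|ca] := lerP (2 * c) (3 * a).
  have h1 := subrX_mul_ge0 6 a0 c0.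
  have h2 : (2 * c) ^+ 7 <= (3 * a) ^+ 7.
    by rewrite lerXn2r // nnegrE mulr_ge0.
  have h3 : 0 <= a ^+ 7 by exact: exprn_ge0.
  rewrite !exprMn in h2; nra.
have ca' := ltW ca.
have h1 : 2 * (a * c ^+ 6) * 3 <= 4 * c ^+ 7.
  have := ler_wpM2r (exprn_ge0 6 c0) ca'; rewrite exprS; lra.
have h2 : (3 * a) ^+ 6 * c <= (2 * c) ^+ 6 * c.
  by rewrite ler_wpM2r // lerXn2r // nnegrE mulr_ge0.
have h3 : 0 <= a ^+ 7 by exact: exprn_ge0.
have h4 : 0 <= c ^+ 7 by exact: exprn_ge0.
rewrite !exprMn in h2.
have e : c ^+ 7 = c * c ^+ 6 by rewrite exprS.
have e' : a ^+ 7 = a * a ^+ 6 by rewrite exprS.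
rewrite e e' in h1 h3 h4 *; nra.
Qed.

(** If [z < 0], deleting [a] or [z] leaves the pairs [z, b] and [a, b].
    On the second one, of constant sign, [h 6] is at least the whole power sum:
    this gains over the factor [1/4] that [even_hsym_ge_psum] gives. *)
Lemma hsym6_ternary_same_sign a b z : 0 <= a -> 0 <= b ->
  14 * (a ^+ 6 + (b ^+ 6 + z ^+ 6)) <= 55 * hsym [:: a; b; z] 6.
Proof.
move=> a0 b0; have [z0|z0] := lerP 0 z.
  have := @hsym_ge_psum _ [:: a; b; z] 5; rewrite !big_cons big_nil addr0 => h.
  have {}h : a ^+ 6 + (b ^+ 6 + z ^+ 6) <= hsym [:: a; b; z] 6.
    by apply: h => y; rewrite !inE => /or3P[] /eqP->.
  have p (t : R) : 0 <= t -> 0 <= t ^+ 6 by exact: exprn_ge0.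
  have := p a a0; have := p b b0; have := p z z0; lra.
have hd := hsym_divdiff a z [:: b] 6.
have hab : a ^+ 6 + b ^+ 6 <= hsym [:: a; b] 6.
  have := @hsym_ge_psum _ [:: a; b] 5; rewrite !big_cons big_nil addr0.
  by apply => y; rewrite !inE => /orP[] /eqP->.
have hzb : z ^+ 6 + b ^+ 6 <= 2 * hsym [:: z; b] 6.
  by have := @even_hsym_ge_psum _ 1 [:: z; b] 2 erefl; rewrite !big_cons big_nil addr0.
have -> : hsym [:: a; b; z] 6 = hsym [:: a; z; b] 6.
  by apply: hsym_perm; rewrite perm_cons (perm_catC [:: b] [:: z]).
set h := hsym [:: a; z; b] 6 in hd *.
have nz : 0 < - z by rewrite oppr_gt0.
have az : 0 < a - z by lra.
have h7 := septic_ge0 a0 (ltW nz).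
have z6 : (- z) ^+ 6 = z ^+ 6 by rewrite (exprM _ 2 3) sqrrN -exprM.
have z7 : (- z) ^+ 7 = - z * z ^+ 6 by rewrite exprS z6.
rewrite z7 z6 (exprS a 6) in h7.
rewrite -(ler_pM2l az) [leRHS]mulrCA hd.
have i1 := ler_wpM2l a0 hab; have i2 := ler_wpM2l (ltW nz) hzb.
have b6 : 0 <= b ^+ 6 by exact: exprn_ge0.
have i3 := mulr_ge0 a0 b6; have i4 := mulr_ge0 (ltW nz) b6.
move: h7 i1 i2 i3 i4; clear.
set A := a ^+ 6; set B := b ^+ 6; set Z := z ^+ 6; set u := hsym _ _; set v := hsym _ _.
move=> h7 i1 i2 i3 i4; lra.
Qed.

Lemma hsym6_ternary_ge x y z :
  14 * (x ^+ 6 + (y ^+ 6 + z ^+ 6)) <= 55 * hsym [:: x; y; z] 6.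
Proof.
suff pos (a b c : R) : 0 <= a * b ->
    14 * (a ^+ 6 + (b ^+ 6 + c ^+ 6)) <= 55 * hsym [:: a; b; c] 6.
  have [xy|xy] := lerP 0 (x * y); first exact: pos.
  have [xz|xz] := lerP 0 (x * z).
    have -> : hsym [:: x; y; z] 6 = hsym [:: x; z; y] 6.
      by apply: hsym_perm; rewrite perm_cons (perm_catC [:: y] [:: z]).
    by have := pos x z y xz; lra.
  have yz : 0 <= y * z.
    rewrite leNgt; apply/negP => yz; have := sqr_ge0 (x * y * z).
    have -> : (x * y * z) ^+ 2 = (x * y) * (x * z) * (y * z) by ring.
    by rewrite leNgt pmulr_rlt0 ?nmulr_rgt0 // yz.
  have -> : hsym [:: x; y; z] 6 = hsym [:: y; z; x] 6.
    by apply: hsym_perm; rewrite (perm_catC [:: x] [:: y; z]).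
  by have := pos y z x yz; lra.
move=> ab; have [] : (0 <= a /\ 0 <= b) \/ (a <= 0 /\ b <= 0).
  have [a0|a0] := lerP 0 a; have [b0|b0] := lerP 0 b; try by [left|right; rewrite !ltW].
    have [->|an] := eqVneq a 0; first by right; rewrite lexx ltW.
    by move: ab; rewrite pmulr_rge0 ?lt_def ?an // leNgt b0.
  by have [->|bn] := eqVneq b 0; [right; rewrite lexx ltW|
     move: ab; rewrite pmulr_lge0 ?lt_def ?bn // leNgt a0].
  by case=> a0 b0; exact: hsym6_ternary_same_sign.
case=> a0 b0; have := @hsym6_ternary_same_sign (- a) (- b) (- c).
rewrite !oppr_ge0 => /(_ a0 b0).
have e6 (t : R) : (- t) ^+ 6 = t ^+ 6 by rewrite (exprM _ 2 3) sqrrN -exprM.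
have := hsymZ (-1) [:: a; b; c] 6; rewrite /= !mulN1r => ->.
by rewrite !e6 expr1n mul1r.
Qed.

Lemma hsym6_size3_ge (s : seq R) : size s = 3%N ->
  14 / 55 * (\sum_(y <- s) y ^+ 6) <= hsym s 6.
Proof.
case: s => [|x [|y [|z [|]]]] // _; rewrite !big_cons big_nil addr0.
rewrite mulrAC ler_pdivrMr // mulrC [leRHS]mulrC [leLHS]mulrC.
exact: hsym6_ternary_ge.
Qed.
End Ternary.

(** * The lower bound *)

(** In terms of [m = n - 1] and of the factor [K] of [regimes]. *)
Lemma muE (R : realType) m d : (0 < m)%N -> (0 < d)%N ->
  let N := 'C(m + d, d) in let K := if odd d then N.+1 else (N + m)%N in
  mu R m.+1 d = 'C(m + 2 * d, 2 * d)%:R / (N * K)%:R.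
Proof.
move=> m0 d0 N K; rewrite /mu eqSS eqn0Ngt m0 /= subn1 /= -/N /K natrM.
by case: (odd d); rewrite ?natr1 // natrD -[m.+1%:R]natr1 addrA addrK.
Qed.

Lemma mu_ge0 (R : realType) m d : (0 < d)%N -> 0 <= mu R m.+1 d.
Proof.
by move=> d0; case: m => [//|m]; rewrite muE // divr_ge0.
Qed.

Lemma lower_bound (R : realType) m d (x : 'I_m.+1 -> R) :
  mu R m.+1 d.+1 / m.+1%:R ^+ d * norm2 x ^+ (2 * d.+1)
    <= hsym [seq x i | i <- enum 'I_m.+1] (2 * d.+1).
Proof.
set s := [seq x i | i <- _].
have ss : size s = m.+1 by rewrite size_map size_enum_ord.
pose s2 := [seq y ^+ 2 | y <- s]; pose S := \sum_(y <- s2) y.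
have ss2 : size s2 = m.+1 by rewrite size_map.
have s2ge0 y : y \in s2 -> 0 <= y by case/mapP => z _ ->; exact: sqr_ge0.
have S0 : 0 <= S by rewrite /S big_seq sumr_ge0.
have -> : norm2 x ^+ (2 * d.+1) = S ^+ d.+1.
  rewrite /norm2 exprM sqr_sqrtr; last by apply: sumr_ge0 => i _; exact: sqr_ge0.
  by rewrite /S /s2 /s !big_map.
have n0 : (0 : R) < m.+1%:R ^+ d by rewrite exprn_gt0 // ltr0n.
rewrite mulrAC ler_pdivrMr //.
have psum : \sum_(y <- s2) y ^+ d.+1 = \sum_(y <- s) y ^+ (2 * d.+1).
  by rewrite big_map; apply: eq_bigr => y _; rewrite exprM.
have hmean : S ^+ d.+1 <= m.+1%:R ^+ d * \sum_(y <- s) y ^+ (2 * d.+1).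
  by rewrite -psum -ss2; exact: power_mean.
(* By [hmean], a bound of [h (2d)] by [t] times the power sum is enough as soon
   as [mu <= t]. *)
have from_psum t : mu R m.+1 d.+1 <= t -> 0 <= t ->
    t * \sum_(y <- s) y ^+ (2 * d.+1) <= hsym s (2 * d.+1) ->
    mu R m.+1 d.+1 * S ^+ d.+1 <= hsym s (2 * d.+1) * m.+1%:R ^+ d.
  move=> mut t0 ht.
  apply: (@le_trans _ _ (t * (m.+1%:R ^+ d * \sum_(y <- s) y ^+ (2 * d.+1)))).
    by apply: ler_pM; rewrite ?mu_ge0 // exprn_ge0.
  by rewrite mulrCA mulrC ler_wpM2r // ltW.
case: m => [|m] in x s ss s2 S ss2 s2ge0 S0 n0 psum hmean from_psum *.
  apply: (from_psum 1) => //; rewrite mul1r.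
  by have := even_hsym_ge_psum d ss; rewrite mul1r.
rewrite muE // in from_psum *.
set M := 'C(_, 2 * d.+1) in from_psum *; set N := 'C(m.+1 + d.+1, d.+1) in from_psum *.
set K := if _ then _ else _ in from_psum *.
have NK0 : (0 < N * K)%N.
  by rewrite muln_gt0 bin_gt0 leq_addl /K; case: (odd _); rewrite // addnS.
have NK0' : (0 : R) < (N * K)%:R by rewrite ltr0n.
case: (@regimes m.+1 d.+1 isT isT).
- rewrite -/M -/N -/K => hM; apply: (from_psum (2 ^+ m.+1)^-1).
  + rewrite ler_pdivrMr // mulrC ler_pdivlMr ?exprn_gt0 ?ltr0n //.
    by rewrite -natrX -natrM ler_nat mulnC.
  + by rewrite invr_ge0 exprn_ge0.
  + rewrite mulrC ler_pdivrMr ?exprn_gt0 ?ltr0n // mulrC.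
    exact: even_hsym_ge_psum.
- set X := 'C(_, d.+1); rewrite -/N -/K => hX.
  pose B := 'C(2 * d.+1, d.+1).
  have B0 : (0 : R) < B%:R by rewrite ltr0n bin_gt0; lia.
  have hMB : (M * B)%N = (N * X)%N by exact: bin_exchange.
  have h1 := even_hsym_ge_sqr s d.+1; have h2 := hsym_ge_mean d.+1 ss2 s2ge0.
  rewrite -/B -/s2 -/N -/S in h1 h2.
  have n0' : (0 : R) < m.+2%:R by rewrite ltr0n.
  have hmu : M%:R / (N * K)%:R * (B%:R * m.+2%:R) <= N%:R :> R.
    rewrite mulrAC ler_pdivrMr // -!natrM ler_nat mulnA hMB -mulnA.
    by rewrite leq_mul2l mulnC hX orbT.
  rewrite -(ler_pM2l (mulr_gt0 B0 n0')) mulrA [X in X * _]mulrC.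
  apply: le_trans (ler_wpM2r (exprn_ge0 _ S0) hmu) _.
  apply: le_trans h2 _; rewrite exprS.
  have -> : B%:R * m.+2%:R * (hsym s (2 * d.+1) * m.+2%:R ^+ d) =
    m.+2%:R * m.+2%:R ^+ d * (B%:R * hsym s (2 * d.+1)) :> R by ring.
  by rewrite ler_wpM2l // mulr_ge0 ?ltW.
- case=> -[m1] [d2]; subst m d; apply: (from_psum (14 / 55)) => //.
  + rewrite ler_pdivrMr // mulrAC ler_pdivlMr // -!natrM ler_nat.
    by vm_compute.
  + by rewrite divr_ge0 ?ler0n.
  + exact: (hsym6_size3_ge ss).
Qed.

Theorem corollary1p2 (R : realType) (n d : nat) (hn : (0 < n)%N) (hd : (0 < d)%N) :
  is_sum_of_squares 'C(n - 1 + d, d) (complete_hsym R n (2 * d))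
  /\ (forall x : 'I_n -> R,
        mu R n d / n%:R ^+ (d - 1) * norm2 x ^+ (2 * d)
          <= (complete_hsym R n (2 * d)).@[x]).
Proof.
case: n hn => [//|m] _; case: d hd => [//|d] _; rewrite !subn1 /=; split.
  rewrite complete_hsymE -size_exps.
  have := even_hsym_sum_squares (@mpolyC m.+1 R) [seq 'X_i | i <- enum 'I_m.+1] d.+1.
  by rewrite size_map size_enum_ord.
by move=> x; rewrite complete_hsym_eval; exact: lower_bound.
Qed.
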